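(* Let $n$ be an even positive integer and let $G=\mathrm{Cay}(\mathbb{Z}_n,S)$ be a circulant graph with $\Delta(G)\ge\frac n2$ whose generating set $S$ satisfies the following properties: (i) $S$ does not contain the involution $\frac n2$; (ii) $S$ has a subset $S_1=\{1,2,3,\ldots,\frac n4,\,n-\frac n4,\ldots,n-1\}$ (the generating set of the power of cycle $C_n^{n/4}$; in particular $\frac n4$ is an integer); (iii) the complement $S\setminus S_1$ generates the whole group $\mathbb{Z}_n$. Then $G$ satisfies the Total Coloring Conjecture, i.e. $\chi''(G)\le\Delta(G)+2$.
   Context: All graphs are finite, simple and undirected. For a group $H$ and a symmetric generating set $S\subset H$ (that is, $s\in S$ implies $s^{-1}\in S$) not containing the identity, the Cayley graph $\mathrm{Cay}(H,S)$ has vertex set $H$ and edges joining $g$ and $gs$ for $g\in H$, $s\in S$. A circulant graph is a Cayley graph on the cyclic group $H=\mathbb{Z}_n$, whose elements are written $0,1,\ldots,n-1$. The power of cycle $C_n^k$ is the circulant graph on $\mathbb{Z}_n$ with generating set $\{1,2,\ldots,k,n-k,\ldots,n-2,n-1\}$. A total coloring of $G$ is a coloring of its vertices and edges such that no two adjacent vertices, no two adjacent edges, and no edge and a vertex incident with it receive the same color; $\chi''(G)$ is the minimum number of colors in a total coloring, and $\Delta(G)$ is the maximum degree. *)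

(* Defs.v *)
From mathcomp Require Import all_boot all_fingroup all_algebra.

Set Implicit Arguments.
Unset Strict Implicit.
Unset Printing Implicit Defensive.

Record sgraph := SGraph {
  vertex :> finType;
  adj : rel vertex;
  adj_sym : symmetric adj;
  adj_irrefl : irreflexive adj
}.

Section Graphs.

Variable G : sgraph.

Definition max_degree : nat := \max_(x : G) #|[set y : G | adj x y]|.

Definition edges : {set {set G}} :=
  [set A : {set G} | [exists x : G, exists y : G, adj x y && (A == [set x; y])]].

Definition edge : predArgType := {A : {set G} | A \in edges}.

Definition total_coloring (k : nat)
    (vc : {ffun G -> 'I_k}) (ec : {ffun edge -> 'I_k}) : bool :=
  [&& [forall x : G, forall y : G, adj x y ==> (vc x != vc y)],
      [forall A : edge, forall B : edge,
         (A != B) && (val A :&: val B != set0) ==> (ec A != ec B)]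
    & [forall A : edge, forall x : G, (x \in val A) ==> (ec A != vc x)]].

Definition total_colorable (k : nat) : bool :=
  [exists vc : {ffun G -> 'I_k}, exists ec : {ffun edge -> 'I_k},
     total_coloring vc ec].

Lemma ex_total_colorable : exists k, total_colorable k.
Proof.
exists (#|G| + #|{: edge}|).
apply/existsP; exists [ffun x => lshift _ (enum_rank x)].
apply/existsP; exists [ffun A => rshift _ (enum_rank A)].
apply/and3P; split.
- apply/forallP=> x; apply/forallP=> y; apply/implyP=> exy.
  rewrite !ffunE (inj_eq (@lshift_inj _ _)) (inj_eq enum_rank_inj).
  by apply: contraTneq exy => ->; rewrite adj_irrefl.
- apply/forallP=> A; apply/forallP=> B; apply/implyP=> /andP[neAB _].
  by rewrite !ffunE (inj_eq (@rshift_inj _ _)) (inj_eq enum_rank_inj).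
- apply/forallP=> A; apply/forallP=> x; apply/implyP=> _.
  by rewrite !ffunE eq_rlshift.
Qed.

Definition total_chromatic_number : nat := ex_minn ex_total_colorable.

End Graphs.

Section Cayley.

Local Open Scope group_scope.

Variable gT : finGroupType.
Implicit Type S : {set gT}.

Definition cayley_set S : Prop :=
  [/\ forall s, s \in S -> s^-1 \in S, 1 \notin S & <<S>> = [set: gT]].

Variables (S : {set gT}) (hS : cayley_set S).

Definition cayley_adj : rel gT := fun g h => [exists s in S, h == g * s].

Lemma cayley_adj_sym : symmetric cayley_adj.
Proof.
have [hV _ _] := hS.
suff imp g h : cayley_adj g h -> cayley_adj h g by move=> g h; apply/idP/idP; apply: imp.
case/exists_inP=> s Ss /eqP->; apply/exists_inP; exists s^-1; first exact: hV.
by rewrite mulgK.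
Qed.

Lemma cayley_adj_irrefl : irreflexive cayley_adj.
Proof.
have [_ h1 _] := hS.
move=> g; apply/negbTE/negP => /exists_inP[s Ss /eqP gs].
have s1 : s = 1 by apply: (mulgI g); rewrite -gs mulg1.
by rewrite -s1 Ss in h1.
Qed.

Definition cayley_graph : sgraph := SGraph cayley_adj_sym cayley_adj_irrefl.

End Cayley.

(* The group law on 'Z_n as a finGroupType is addition modulo n, with identity 0
   (for 1 < n). An element of 'Z_n coerces to its representative in
   {0, ..., n - 1}, so the inequalities below are between natural numbers. *)
Definition power_cycle_set (n k : nat) : {set 'Z_n} :=
  [set x : 'Z_n | (1 <= x <= k) || (n - k <= x <= n - 1)]%N.

(* Main.v *)
(* Write n = 4m and T = S \ S_1; the two parts get 2m + 2 and |T| colors.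
   Reduction mod 2m maps the power of cycle C_4m^m onto K_2m, identifying only the
   non-adjacent pairs {x, x + 2m} and folding no two edges at a vertex except those
   of difference m.  Deleting a vertex of K_(2m+1), properly edge-colored by sums
   mod 2m + 1, gives a total coloring of K_2m with distinct vertex colors; its pull
   back needs one more color for half of the edges of difference m.
   As T generates Z_n it contains an odd element, and then Cay(Z_n, T) is
   |T|-edge-colorable, by Vizing's theorem for the even differences. *)
Require Import Defs.
From mathcomp Require Import all_boot all_fingroup all_algebra zify.
Import GRing.Theory.

Set Implicit Arguments.
Unset Strict Implicit.
Unset Printing Implicit Defensive.

(** * Vizing's theorem *)

(** The neighbors of an inner vertex are its predecessor and successor, and each end has only its
    neighbor on the path; so no edge leaves the path. *)
Lemma path_ends_closed (V : finType) (R : rel V) (x : V) (s : seq V) :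
  symmetric R ->
  (forall u v w z, R u v -> R u w -> R u z -> [|| v == w, v == z | w == z]) ->
  (forall v w, R x v -> R x w -> v = w) ->
  (forall v w, R (last x s) v -> R (last x s) w -> v = w) ->
  s != [::] -> path R x s -> uniq (x :: s) ->
  forall u v, R u v -> u \in x :: s -> v \in x :: s.
Proof.
move=> symR deg2 degx degl s0 Rs us.
move=> u v Ruv; rewrite !inE => /orP[/eqP ux|us'].
  case: s s0 Rs {us degl} => // y s _ /= /andP[Rxy _].
  by rewrite ux in Ruv; rewrite (degx _ _ Ruv Rxy) inE eqxx orbT.
case/splitPr: s / us' s0 Rs us degl => s1 s2 _.
rewrite cat_path /= => /and3P[_ Rlu Rus2] us degl.
have lin : last x s1 \in x :: s1 by apply: mem_last.
case: s2 Rus2 us degl => [|w s2] /=.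
  move=> _ _; rewrite last_cat /= => degl.
  rewrite (degl v (last x s1) Ruv) 1?symR //.
  by move: lin; rewrite inE mem_cat => /orP[->//|->]; rewrite !orbT.
move=> /andP[Ruw _] us _; rewrite symR in Rlu.
have := deg2 _ _ _ _ Ruv Rlu Ruw; case/or3P=> /eqP.
- by move=> ->; move: lin; rewrite inE mem_cat => /orP[->//|->]; rewrite !orbT.
- by move=> ->; rewrite mem_cat !inE eqxx !orbT.
move=> lw; move: us; rewrite -/(uniq (x :: (s1 ++ u :: w :: s2))) -cat_cons cat_uniq.
case/and3P=> _ /hasPn /(_ w) + _; rewrite !inE eqxx orbT => /(_ isT) /=.
by rewrite -lw -in_cons lin.
Qed.


(** A path from x to p fills its component. If q were on it, q would be an inner vertex with two
    distinct neighbors. *)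
Lemma connect_three_ends (V : finType) (R : rel V) (x p q : V) :
  symmetric R ->
  (forall u v w z, R u v -> R u w -> R u z -> [|| v == w, v == z | w == z]) ->
  (forall u v w, u \in [:: x; p; q] -> R u v -> R u w -> v = w) ->
  uniq [:: x; p; q] -> connect R x p -> ~~ connect R x q.
Proof.
move=> symR deg2 deg1 uxpq /connectP[s0 Rs0 pl].
rewrite {p}pl in deg1 uxpq *.
case/shortenP: Rs0 deg1 uxpq => s Rs us _ {s0} deg1 uxpq.
have s0 : s != [::] by apply: contraTneq uxpq => -> /=; rewrite inE eqxx.
have degx v w : R x v -> R x w -> v = w by apply: deg1; rewrite inE eqxx.
have degl v w : R (last x s) v -> R (last x s) w -> v = w.
  by apply: deg1; rewrite !inE eqxx orbT.
have cls := path_ends_closed symR deg2 degx degl s0 Rs us.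
have clC : closed R (mem (x :: s)) by exact: (intro_closed (sym_connect_sym symR)).
apply/negP => /(closed_connect clC); rewrite mem_head => /esym.
move: uxpq; rewrite /= !inE negb_or andbT => /andP[/andP[_ nxq] nlq].
rewrite eq_sym (negbTE nxq) /= => qs.
have degq v w : R q v -> R q w -> v = w by apply: deg1; rewrite !inE eqxx !orbT.
case/splitPr: s / qs Rs us nlq {degl s0 clC deg1 cls} => s1 [|w s2].
  by rewrite last_cat /= eqxx.
rewrite cat_path /= => /and4P[_ Rlq Rqw _] us _.
rewrite symR in Rlq.
move: us; rewrite -/(uniq (x :: (s1 ++ q :: w :: s2))) -cat_cons cat_uniq.
case/and3P=> _ /hasPn /(_ w) + _; rewrite !inE eqxx orbT => /(_ isT) /=.
by rewrite -(degq _ _ Rlq Rqw) -in_cons mem_last.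
Qed.

(** * Partial edge colorings and fans *)

(** [None] marks the non-edges; a coloring with the single edge xy left uncolored is thus an
    [edge_coloring] of [del_edge e x y]. *)
Definition edge_coloring (V : finType) (k : nat) (e : rel V)
    (c : V -> V -> option 'I_k) : Prop :=
  [/\ forall u v, c u v = c v u,
      forall u v, (c u v != None) = e u v
    & forall u v w a, c u v = Some a -> c u w = Some a -> v = w].

Definition missing (V : finType) (k : nat) (c : V -> V -> option 'I_k)
    (u : V) (a : 'I_k) : bool :=
  [forall v, c u v != Some a].

Definition same_ends (V : eqType) (x y u v : V) : bool :=
  (u == x) && (v == y) || (u == y) && (v == x).

Definition del_edge (V : eqType) (e : rel V) (x y : V) : rel V :=
  fun u v => e u v && ~~ same_ends x y u v.

Definition recolor (V : eqType) (C : Type) (c : V -> V -> C) (x y : V) (o : C) :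
    V -> V -> C :=
  fun u v => if same_ends x y u v then o else c u v.

Lemma same_endsC (V : eqType) (x y u v : V) :
  same_ends x y u v = same_ends x y v u.
Proof. by rewrite /same_ends orbC [(v == y) && _]andbC [(v == x) && _]andbC. Qed.

Section Vizing.

Variables (V : finType) (k : nat).
Implicit Types (e : rel V) (c : V -> V -> option 'I_k).

Lemma eq_edge_coloring e e' c :
  e =2 e' -> edge_coloring e c -> edge_coloring e' c.
Proof. by move=> ee' [sc ec pc]; split=> // u v; rewrite -ee'. Qed.

Lemma uncolor_edge e c x y :
  edge_coloring e c -> edge_coloring (del_edge e x y) (recolor c x y None).
Proof.
case=> sc ec pc; split=> [u v|u v|u v w a]; rewrite /recolor /del_edge.
- by rewrite same_endsC sc.
- by case: same_ends; rewrite /= ?andbF ?andbT.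
by case: same_ends; case: same_ends => //; apply: pc.
Qed.

Lemma color_edge e c x y a :
  symmetric e -> e x y -> x != y -> edge_coloring (del_edge e x y) c ->
  missing c x a -> missing c y a -> edge_coloring e (recolor c x y (Some a)).
Proof.
move=> se exy nxy [sc ec pc] /forallP mx /forallP my.
have nyx : y != x by rewrite eq_sym.
split=> [u v|u v|u v w b]; rewrite /recolor.
- by rewrite same_endsC sc.
- case: ifP => [|neq]; last by rewrite ec /del_edge neq andbT.
  by case/orP=> /andP[/eqP-> /eqP->]; rewrite /= ?exy // se exy.
rewrite /same_ends; case: (u =P x) => [->|_] /=.
  rewrite (negbTE nxy) /= !orbF; case: (v =P y) => [->|_]; case: (w =P y) => [->|_] //.
  - by case=> <- /eqP; rewrite (negbTE (mx w)).
  - by move=> + [ab]; rewrite -ab => /eqP; rewrite (negbTE (mx v)).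
  exact: pc.
case: (u =P y) => [->|_] /=; last exact: pc.
case: (v =P x) => [->|_]; case: (w =P x) => [->|_] //.
- by case=> <- /eqP; rewrite (negbTE (my w)).
- by move=> + [ab]; rewrite -ab => /eqP; rewrite (negbTE (my v)).
exact: pc.
Qed.

(* Moving the color of xz to xy makes xz the only uncolored edge, with z :: s as
   its fan. *)
Lemma fan_shift e x (mis : V -> 'I_k) a s : forall y c,
  symmetric e -> e x y -> edge_coloring (del_edge e x y) c ->
  path (fun u v => c x v == Some (mis u)) y s -> uniq [:: x, y & s] ->
  all (fun u => missing c u (mis u)) (belast y s) ->
  missing c (last y s) a -> missing c x a ->
  exists c', edge_coloring e c'.
Proof.
elim: s => [|z s IHs] y c se exy cc.
  rewrite /= inE andbT => _ nxy _ my mx.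
  by exists (recolor c x y (Some a)); apply: color_edge.
rewrite /= => /andP[/eqP xz pz] /and4P[].
rewrite !inE !negb_or => /and3P[nxy nxz xs] /andP[nyz ys] zs us.
case/andP=> my ms ml mx.
set b := mis y in xz my.
have [sc ec pc] := cc.
have exz : e x z.
  by have := ec x z; rewrite xz /= => /esym/andP[].
set c0 := recolor c x z None.
set c1 := recolor c0 x y (Some b).
have c1E u : u != y -> u != x -> forall d, missing c u d -> missing c1 u d.
  move=> nuy nux d /forallP mu; apply/forallP => v.
  rewrite /c1 /c0 /recolor /same_ends (negbTE nuy) (negbTE nux) /=.
  by case: ifP.
have nab : b != a.
  by apply/eqP => ba; move/forallP: mx => /(_ z); rewrite xz ba eqxx.
have c1x d : b != d -> missing c x d -> missing c1 x d.
  move=> nbd /forallP md; apply/forallP => v.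
  rewrite /c1 /c0 /recolor /same_ends eqxx (negbTE nxy) (negbTE nxz) /= !orbF.
  by case: ifP => // _; case: ifP.
apply: (IHs z c1) => //.
- apply: color_edge => //.
  + by move=> u v; rewrite /del_edge se same_endsC.
  + rewrite /del_edge exy /same_ends eqxx /= (negbTE nxz) orbF.
    by rewrite (negbTE nyz).
  + apply: eq_edge_coloring (uncolor_edge x z cc) => u v.
    by rewrite /del_edge andbAC.
  + apply/forallP => v; rewrite /c0 /recolor /same_ends eqxx (negbTE nxz) /= orbF.
    case: (v =P z) => //= nvz; apply/eqP => xv; apply: nvz.
    exact: pc xv xz.
  + apply/forallP => v; rewrite /c0 /recolor /same_ends (negbTE nyz) /=.
    by rewrite [y == x]eq_sym (negbTE nxy) /=; move/forallP: my.
- have sub : all (fun v => [&& v != x, v != y & v != z]) s.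
    apply/allP => v vs; apply/and3P; split.
    + by apply: contraNneq xs => <-.
    + by apply: contraNneq ys => <-.
    by apply: contraNneq zs => <-.
  have pathE r u : all (fun v => [&& v != x, v != y & v != z]) r ->
      path (fun u v => c x v == Some (mis u)) u r ->
      path (fun u v => c1 x v == Some (mis u)) u r.
    elim: r u => //= v r IHr u /andP[/and3P[nvx nvy nvz] ar] /andP[cv pr].
    rewrite IHr // andbT /c1 /c0 /recolor /same_ends.
    by rewrite (negbTE nvx) (negbTE nvy) (negbTE nvz) !andbF.
  exact: pathE.
- by rewrite /= !inE negb_or nxz xs zs us.
- apply/allP => u us'; apply: c1E; last by move/allP: ms; apply.
  + by move/mem_belast: us'; apply: contraTneq => ->; rewrite inE negb_or nyz.
  by move/mem_belast: us'; apply: contraTneq => ->; rewrite inE negb_or nxz.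
- apply: c1E => //; have := mem_last z s; apply: contraTneq => ->.
    by rewrite inE negb_or nyz.
  by rewrite inE negb_or nxz.
exact: c1x.
Qed.

(** * Kempe chains *)

Definition kempe_rel c (a b : 'I_k) : rel V :=
  fun u v => c u v \in [:: Some a; Some b].

(** Testing u alone is enough: an edge colored a or b has both ends in the component of t or
    neither, and [tperm a b] fixes all other colors. *)
Definition kempe_swap c (a b : 'I_k) (t : V) : V -> V -> option 'I_k :=
  fun u v => if connect (kempe_rel c a b) t u then omap (tperm a b) (c u v)
             else c u v.

Lemma kempe_rel_sym e c a b : edge_coloring e c -> symmetric (kempe_rel c a b).
Proof. by case=> sc _ _ u v; rewrite /kempe_rel sc. Qed.

Lemma kempe_swap_coloring e c a b t :
  edge_coloring e c -> edge_coloring e (kempe_swap c a b t).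
Proof.
move=> cc; have symR := kempe_rel_sym a b cc; case: cc => sc ec pc.
have swapE u v : ~~ connect (kempe_rel c a b) t u ->
    connect (kempe_rel c a b) t v -> omap (tperm a b) (c v u) = c v u.
  move=> tu tv; have : ~~ kempe_rel c a b v u.
    by apply: contra tu => vu; apply: connect_trans tv (connect1 vu).
  rewrite /kempe_rel !inE; case: (c v u) => //= d.
  by rewrite !(inj_eq Some_inj) negb_or => /andP[da db]; rewrite tpermD // eq_sym.
split=> [u v|u v|u v w d]; rewrite /kempe_swap.
- case: ifPn => tu; case: ifPn => tv; first by rewrite sc.
  + by rewrite swapE // sc.
  + by rewrite sc swapE.
  by rewrite sc.
- by rewrite -ec; case: ifP => // _; case: (c u v).
case: ifP => _; last exact: pc.
case cv: (c u v) => [d1|] //= [<-]; case cw: (c u w) => [d2|] //= [].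
by move/perm_inj => d21; apply: pc cv _; rewrite cw d21.
Qed.

Lemma kempe_missing c a b t u d :
  missing (kempe_swap c a b t) u d =
  missing c u (if connect (kempe_rel c a b) t u then tperm a b d else d).
Proof.
apply: eq_forallb => v; rewrite /kempe_swap; case: ifP => // _.
case: (c u v) => //= f; rewrite !(inj_eq Some_inj).
by rewrite -[in RHS](inj_eq (@perm_inj _ (tperm a b))) tpermK.
Qed.

(** Each vertex has at most two edges colored a or b, and at most one if it misses a or b; a Kempe
    chain has room for only two such ends. *)
Lemma kempe_ends e c a b x p q :
  edge_coloring e c -> uniq [:: x; p; q] ->
  (forall u, u \in [:: x; p; q] -> missing c u a || missing c u b) ->
  connect (kempe_rel c a b) x p -> ~~ connect (kempe_rel c a b) x q.
Proof.
move=> cc uxpq mab; have [_ _ pc] := cc.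
apply: connect_three_ends => //; first exact: kempe_rel_sym cc.
  move=> u v w z; rewrite /kempe_rel !inE.
  by do 3![case/orP=> /eqP ?]; apply/or3P;
    first [constructor 1; apply/eqP; apply: pc; eassumption
          |constructor 2; apply/eqP; apply: pc; eassumption
          |constructor 3; apply/eqP; apply: pc; eassumption].
move=> u v w /mab /orP[] /forallP mu; rewrite /kempe_rel !inE;
  rewrite ?(negbTE (mu _)) ?orbF /=; move=> /eqP uv /eqP uw; exact: pc uv uw.
Qed.

(** * Inserting the last edge *)

Lemma path_belast (T : eqType) (r : rel T) (y u : T) (s : seq T) :
  path r y s -> u \in belast y s -> exists2 v, v \in s & r u v.
Proof.
elim: s y => //= z s IHs y /andP[ryz ps]; rewrite inE => /orP[/eqP->|].
  by exists z; rewrite ?mem_head.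
by case/(IHs _ ps) => v vs ruv; exists v; rewrite // inE vs orbT.
Qed.

(** Swapping a and [mis t] on the chain of the last fan vertex t makes a missing at t as well as at
    x. The two conditions on the chain keep the colors at x and the missing colors of the earlier
    fan vertices, so the fan can be shifted. *)
Lemma kempe_fan e c x y s (mis : V -> 'I_k) a :
  symmetric e -> e x y -> edge_coloring (del_edge e x y) c ->
  path (fun u v => c x v == Some (mis u)) y s -> uniq [:: x, y & s] ->
  all (fun u => missing c u (mis u)) (y :: s) -> missing c x a ->
  let t := last y s in let R := kempe_rel c a (mis t) in
  ~~ connect R t x ->
  {in belast y s, forall u, mis u = mis t -> ~~ connect R t u} ->
  exists c', edge_coloring e c'.
Proof.
move=> se exy cc ps us ms mx t R ntx nt.
(* The next fan edge carries [mis u] at x, where a is missing. *)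
have misN u : u \in belast y s -> mis u != a.
  case/(path_belast ps) => v _ /eqP cxv; apply: contraTneq mx => <-.
  by apply/forallPn; exists v; rewrite negbK cxv.
apply: (@fan_shift e x mis a s y (kempe_swap c a (mis t) t)) => //.
- exact: kempe_swap_coloring.
- by apply: sub_path ps => u v; rewrite /kempe_swap (negbTE ntx).
- apply/allP => u ub; rewrite kempe_missing.
  have mu : missing c u (mis u) by move/allP: ms; apply; apply: mem_belast.
  case: ifPn => // tu; rewrite tpermD // 1?eq_sym ?misN //.
  by apply: contraTneq tu => /nt; apply.
- rewrite kempe_missing connect0 tpermL; move/allP: ms; apply; exact: mem_last.
by rewrite kempe_missing (negbTE ntx).
Qed.

(** A fan grows until the missing color of its last vertex q is missing at x, and the fan is
    shifted, or is the color of a fan edge xz. Then q and the predecessor p of z have the same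
    chosen missing color, and a Kempe swap at p or at q finishes, since x, p, q are not all on one
    chain. *)
Lemma color_last_edge e c x y :
  symmetric e -> irreflexive e -> e x y -> edge_coloring (del_edge e x y) c ->
  (forall u, exists a, missing c u a) -> exists c', edge_coloring e c'.
Proof.
move=> se ie exy cc exm; have [sc ec pc] := cc.
pose mis u := xchoose (exm u).
have mP u : missing c u (mis u) by apply: xchooseP.
pose F u v := c x v == Some (mis u).
have all_mis s : all (fun u => missing c u (mis u)) s by apply/allP.
have fan s : path F y s -> uniq [:: x, y & s] -> exists c', edge_coloring e c'.
  have [n] := ubnP (#|V| - size s).
  elim: n s => // n IHn s lt_n ps us.
  case mx: (missing c x (mis (last y s))).
    exact: (@fan_shift e x mis (mis (last y s)) s y c).
  move/negbT: mx => /forallPn[z]; rewrite negbK => cxz.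
  have nzx : z != x.
    apply/eqP => zx; have := ec x x; rewrite -{2}zx (eqP cxz) /=.
    by rewrite /del_edge ie.
  have [zs|zs] := boolP (z \in y :: s); last first.
    have uz : uniq [:: x, y & rcons s z].
      rewrite -[X in uniq X]/(rcons [:: x, y & s] z) rcons_uniq us andbT.
      by rewrite inE negb_or nzx.
    apply: (IHn (rcons s z)) => //; last by rewrite rcons_path ps.
    have : size [:: x, y & rcons s z] <= #|V|.
      by rewrite -(card_uniqP uz) max_card.
    by rewrite /= size_rcons; move: lt_n; move: #|V| (size s) => N l; lia.
  have zy : z != y.
    apply/eqP => zy; have := ec x y; rewrite -{1}zy (eqP cxz) /del_edge.
    by rewrite /same_ends !eqxx andbF.
  move: zs; rewrite inE (negbTE zy) /= => zs.
  case/splitPr: s / zs ps us lt_n cxz => s1 s2 ps us _.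
  have -> : last y (s1 ++ z :: s2) = last z s2 by rewrite last_cat.
  set q := last z s2; set p := last y s1 => cxz.
  have psz := ps; move: psz; rewrite cat_path /= => /and3P[ps1 /eqP cxz' ps2].
  have pq : mis p = mis q by move: cxz; rewrite cxz' => /eqP[].
  have [a ma] := exm x.
  have us' := us; move: us'; rewrite -[X in uniq X]/((x :: y :: s1) ++ z :: s2).
  rewrite cat_uniq => /and3P[us1 dis us2].
  have pin : p \in y :: s1 := mem_last y s1.
  have qin : q \in z :: s2 := mem_last z s2.
  (* Only xz has color [mis q] at x, so a fan vertex whose successor is not z has a chosen missing
     color other than [mis q]. *)
  have only_p u v : v \in s1 ++ s2 -> c x v = Some (mis u) -> mis u <> mis q.
    rewrite mem_cat => vs cxv uq.
    have vz : v = z by apply: pc cxv _; rewrite uq (eqP cxz).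
    move: vs; rewrite vz; case/andP: us2 => /negbTE -> _; rewrite orbF => zs1.
    by move/hasPn: dis => /(_ z (mem_head _ _)); rewrite !inE zs1 !orbT.
  have uxpq : uniq [:: x; p; q].
    rewrite /= !inE andbT negb_or; apply/andP; split; last first.
      apply: contraNneq dis => pq'; apply/hasP; exists q => //.
      by rewrite inE -pq' pin orbT.
    apply/andP; split.
      by case/andP: us1 => + _; apply: contraNneq => ->.
    apply: contraNneq dis => xq; apply/hasP; exists q => //.
    by rewrite -xq mem_head.
  (* If the chain of x contains p, it avoids q, and the whole fan is used with the swap at q;
     otherwise the fan is cut at p, with the swap there. *)
  have [xp|xp] := boolP (connect (kempe_rel c a (mis q)) x p).
    have xq : ~~ connect (kempe_rel c a (mis q)) x q.
      apply: kempe_ends cc uxpq _ xp => u; rewrite !inE.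
      by case/or3P=> /eqP->; rewrite ?ma ?mP ?orbT // -pq mP orbT.
    have symR := sym_connect_sym (kempe_rel_sym a (mis q) cc).
    apply: (kempe_fan se exy cc ps us (all_mis _) ma); rewrite last_cat -/q.
      by rewrite symR.
    move=> u; rewrite belast_cat /= mem_cat inE.
    case/or3P=> [us1'|/eqP->|us2'] uq.
    + case: (path_belast ps1 us1') => v vs /eqP cxv.
      by case: (only_p u v _ cxv); rewrite ?mem_cat ?vs.
    + by apply: contra xq => qp; apply: connect_trans xp _; rewrite symR.
    + case: (path_belast ps2 us2') => v vs /eqP cxv.
      by case: (only_p u v _ cxv); rewrite ?mem_cat ?vs ?orbT.
  apply: (kempe_fan se exy cc ps1 us1 (all_mis _) ma); rewrite -/p pq.
    by rewrite (sym_connect_sym (kempe_rel_sym a (mis q) cc)).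
  move=> u us1' uq; case: (path_belast ps1 us1') => v vs /eqP cxv.
  by case: (only_p u v _ cxv); rewrite ?mem_cat ?vs.
apply: (fan [::]) => //=; rewrite inE andbT.
by apply: contraTneq exy => ->; rewrite ie.
Qed.

Lemma exists_missing e c u :
  edge_coloring e c -> #|[set v | e u v]| < k -> exists a, missing c u a.
Proof.
case=> sc ec pc dk; apply/existsP; apply: contraTT dk => /existsPn noa.
have ex a : exists v, c u v == Some a.
  by have /forallPn[v] := noa a; rewrite negbK; exists v.
pose f a := xchoose (ex a).
have fP a : c u (f a) = Some a by apply/eqP; apply: (xchooseP (ex a)).
rewrite -leqNgt -[k in k <= _]card_ord -(@card_imset _ _ f); last first.
  by move=> a b fab; have := fP b; rewrite -fab fP => -[].
apply/subset_leq_card/subsetP => v /imsetP[a _ ->].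
by rewrite inE -ec fP.
Qed.

(** Induction on the number of adjacent pairs: one edge is deleted and put back by
    [color_last_edge]. Degrees below k leave a missing color at every vertex. *)
Theorem vizing e :
  symmetric e -> irreflexive e -> (forall u, #|[set v | e u v]| < k) ->
  exists c, edge_coloring e c.
Proof.
have [n] := ubnP #|[set p : V * V | e p.1 p.2]|.
elim: n e => // n IHn e lt_n se ie dk.
case: (pickP (fun p : V * V => e p.1 p.2)) => [[x y] /= exy|e0]; last first.
  exists (fun _ _ => None); split=> // u v.
  by rewrite (e0 (u, v)).
have sub u v : del_edge e x y u v -> e u v by case/andP.
have se' : symmetric (del_edge e x y).
  by move=> u v; rewrite /del_edge se same_endsC.
have dk' u : #|[set v | del_edge e x y u v]| < k.
  apply: leq_ltn_trans (dk u); apply/subset_leq_card/subsetP => v.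
  by rewrite !inE; apply: sub.
have [||c cc] := IHn _ _ se' _ dk'.
- apply: leq_trans (_ : #|[set p | e p.1 p.2]| <= n); last by rewrite -ltnS.
  apply/proper_card/properP; split.
    by apply/subsetP => p; rewrite !inE; apply: sub.
  by exists (x, y); rewrite !inE //= /del_edge /same_ends !eqxx andbF.
- by move=> u; rewrite /del_edge ie.
by apply: (color_last_edge se ie exy cc) => u; apply: exists_missing cc (dk' u).
Qed.

End Vizing.

(** * Total colorings of cyclic Cayley graphs *)

(** This allows edges to be colored as ordered pairs by natural numbers; the symmetry of c makes the
    color independent of the pair chosen to represent an edge. *)
Lemma total_colorable_nat (G : sgraph) (k : nat) (vc : G -> nat) (c : G -> G -> nat) :
  (forall x, vc x < k) -> (forall x y, adj x y -> c x y < k) ->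
  (forall x y, adj x y -> c x y = c y x) ->
  (forall x y, adj x y -> vc x <> vc y) ->
  (forall x y z, adj x y -> adj x z -> c x y = c x z -> y = z) ->
  (forall x y, adj x y -> c x y <> vc x) ->
  total_colorable G k.
Proof.
move=> vk ck sc pv pc vec.
have edgeP (A : edge G) : exists p : G * G, adj p.1 p.2 && (val A == [set p.1; p.2]).
  have := valP A; rewrite inE => /existsP[x /existsP[y xyA]].
  by exists (x, y).
pose f A := xchoose (edgeP A).
have fP A : adj (f A).1 (f A).2 by case/andP: (xchooseP (edgeP A)).
have fE (A : edge G) : val A = [set (f A).1; (f A).2].
  by apply/eqP; case/andP: (xchooseP (edgeP A)).
pose cA A := Ordinal (ck _ _ (fP A)).
have cAE (A : edge G) (x : G) : x \in val A ->
    exists y, [/\ adj x y, val A = [set x; y] & val (cA A) = c x y].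
  rewrite fE !inE => /orP[] /eqP->; first by exists (f A).2; rewrite fP.
  exists (f A).1; rewrite adj_sym fP setUC; split=> //=.
  by rewrite sc // fP.
apply/existsP; exists [ffun x => Ordinal (vk x)].
apply/existsP; exists [ffun A => cA A].
apply/and3P; split.
- apply/forallP=> x; apply/forallP=> y; apply/implyP=> exy.
  by rewrite !ffunE -val_eqE; apply/eqP/pv.
- apply/forallP=> A; apply/forallP=> B; apply/implyP=> /andP[neAB].
  case/set0Pn=> x /setIP[/cAE[y [xy Ay cAy]] /cAE[z [xz Bz cBz]]].
  rewrite !ffunE; apply: contra neAB => /eqP cAB.
  by apply/eqP/val_inj; rewrite /= Ay Bz (pc x y z) // -cAy -cBz cAB.
- apply/forallP=> A; apply/forallP=> x; apply/implyP=> /cAE[y [xy _ cAy]].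
  by rewrite !ffunE -val_eqE cAy; apply/eqP/vec.
Qed.

(** * A total coloring of the power of cycle with 2m + 2 colors *)

Section ShortEdges.

Variable m : nat.
Implicit Types x y z : nat.

Definition dist x y : nat := (x - y) + (y - x).

(** For residues below 4m this is adjacency in C_4m^m: cyclic distance at most m. *)
Definition short x y : bool := (x != y) && ((dist x y <= m) || (3 * m <= dist x y)).

Definition sum_color i j : nat := (i + j) %% (2 * m).+1.

(* The index 2 * m stands for the extra vertex of K_(2m+1). *)
Definition vertex_color x : nat := sum_color (x %% (2 * m)) (2 * m).

(* The 4-cycle x, x + m, x + 2m, x + 3m covers a single edge of K_2m twice; every
   other edge of it gets the additional color 2m + 1. *)
Definition extra_edge x y : bool :=
  (dist x y == 3 * m) || (dist x y == m) && (m <= minn x y < 2 * m).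

Definition short_color x y : nat :=
  if extra_edge x y then (2 * m).+1 else sum_color (x %% (2 * m)) (y %% (2 * m)).

Lemma sum_color_inj i j k : j < (2 * m).+1 -> k < (2 * m).+1 ->
  sum_color i j = sum_color i k -> j = k.
Proof.
by move=> jm km /eqP; rewrite /sum_color eqn_modDl !modn_small // => /eqP.
Qed.

Lemma modn_eq_dist x y : x < 4 * m -> y < 4 * m ->
  x %% (2 * m) = y %% (2 * m) -> x = y \/ dist x y = 2 * m.
Proof.
have modE z : z < 4 * m -> z %% (2 * m) = if z < 2 * m then z else z - 2 * m.
  move=> zm; case: ifPn => [|nzm]; first exact: modn_small.
  by rewrite -[in LHS](@subnK (2 * m) z) ?modnDr ?modn_small //; lia.
by move=> xm ym; rewrite !modE // /dist; do 2![case: ifP]; lia.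
Qed.

Hypothesis m_gt0 : 0 < m.

Let mod_lt x : x %% (2 * m) < 2 * m.
Proof. by rewrite ltn_pmod //; lia. Qed.

Lemma short_colorC x y : short_color x y = short_color y x.
Proof.
rewrite /short_color /extra_edge /dist /sum_color minnC.
by rewrite [_ - _ + _]addnC [_ %% _ + _]addnC.
Qed.

Lemma shortC x y : short x y = short y x.
Proof. by rewrite /short /dist eq_sym addnC. Qed.

Lemma vertex_color_lt x : vertex_color x < (2 * m).+1.
Proof. exact: ltn_pmod. Qed.

Lemma short_color_lt x y : short_color x y < (2 * m).+2.
Proof. by rewrite /short_color; case: ifP => // _; apply/leqW/ltn_pmod. Qed.

Lemma vertex_color_inj x y : x < 4 * m -> y < 4 * m ->
  x != y -> dist x y != 2 * m -> vertex_color x <> vertex_color y.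
Proof.
move=> xm ym nxy dxy; rewrite /vertex_color /sum_color ![_ + 2 * m]addnC.
move/sum_color_inj; rewrite !ltnS !(ltnW (mod_lt _)) => /(_ isT isT).
by case/modn_eq_dist => //; apply/eqP.
Qed.

(** The extra color exceeds all vertex colors; equality of the sums would make y mod 2m the index 2m
    of the deleted vertex. *)
Lemma short_color_vertex x y : short x y -> short_color x y <> vertex_color x.
Proof.
move=> sxy; have := vertex_color_lt x.
rewrite /short_color; case: ifP => _; first by lia.
move=> _ /sum_color_inj; have := mod_lt y; lia.
Qed.

(** Equal sums make y and z congruent mod 2m. If they differ, both are at cyclic distance m from x,
    and exactly one of the two edges is extra. *)
Lemma short_color_inj x y z : x < 4 * m -> y < 4 * m -> z < 4 * m ->
  short x y -> short x z -> short_color x y = short_color x z -> y = z.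
Proof.
move=> xm ym zm; rewrite /short_color.
have sum_lt i j : sum_color i j < (2 * m).+1 by apply: ltn_pmod.
case: ifP => bxy; case: ifP => bxz.
- by move: bxy bxz; rewrite /extra_edge /short /dist; lia.
- by have := sum_lt (x %% (2 * m)) (z %% (2 * m)); lia.
- by have := sum_lt (x %% (2 * m)) (y %% (2 * m)); lia.
move=> sxy sxz /sum_color_inj.
rewrite !ltnS !(ltnW (mod_lt _)) => /(_ isT isT) /modn_eq_dist -/(_ ym zm)[] //.
by move: bxy bxz sxy sxz; rewrite /extra_edge /short /dist; lia.
Qed.

End ShortEdges.

(** * Edge colorings of circulant graphs of even order *)

Section EvenCyclic.

Variable n : nat.
Hypotheses (n_gt1 : 1 < n) (n_even : ~~ odd n).
Local Open Scope ring_scope.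
Implicit Types x y z : 'Z_n.

Lemma Zn_lt x : (x < n)%N.
Proof. by rewrite -[X in (_ < X)%N](Zp_cast n_gt1). Qed.

Lemma val_subZ x y : (y - x : 'Z_n) = (if x <= y then y - x else n + y - x)%N :> nat.
Proof.
have xn := Zn_lt x; have yn := Zn_lt y.
(* The modulus of ['Z_n] equals n only through [Zp_cast]; the variable k makes it rewritable. *)
suff E k : k = n ->
    ((y + (k - x) %% k) %% k = if x <= y then y - x else n + y - x)%N.
  exact: E (Zp_cast n_gt1).
move=> ->; rewrite modnDmr; case: leqP => xy.
  by rewrite addnBA ?[(y + n)%N]addnC 1?ltnW // -addnBA // modnDl modn_small //; lia.
by rewrite addnBA 1?ltnW // addnC modn_small //; lia.
Qed.

(** As n is even, reduction mod n preserves parity. *)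
Lemma odd_subZ x y : odd (x - y)%R = odd x (+) odd y.
Proof.
have xn := Zn_lt x; have yn := Zn_lt y; move/negbTE: n_even => on.
by rewrite val_subZ; case: leqP => xy; rewrite oddB ?oddD ?on //; lia.
Qed.

Lemma odd_addZ x y : odd (x + y)%R = odd x (+) odd y.
Proof.
by rewrite -[y in LHS]opprK odd_subZ -sub0r odd_subZ.
Qed.

(* An odd edge is identified with the difference b from its even end to its odd
   end, so these differences properly color the odd edges. A Vizing coloring of
   the even edges, copied from the even to the odd residues along translation by
   a, misses a common color at x and x + a, which the edges of difference a can
   use. *)
Lemma even_circulant_class1 (T : {set 'Z_n}) (a : 'Z_n) :
  (forall t, t \in T -> - t \in T) -> 0 \notin T -> a \in T -> odd a ->
  exists c : 'Z_n -> 'Z_n -> nat,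
    [/\ forall x y, y - x \in T -> (c x y < #|T|)%N,
        forall x y, y - x \in T -> c x y = c y x
      & forall x y z, y - x \in T -> z - x \in T -> c x y = c x z -> y = z].
Proof.
move=> symT T0 aT oa.
pose E := [set t in T | ~~ odd (t : 'Z_n)]; pose O := [set t in T | odd (t : 'Z_n)].
(* Vizing takes |E| + 1 colors; the additional one is paid for by a, whose edges reuse missing
   colors. *)
have cardT : (#|E| + #|O :\ a|).+1 = #|T|.
  rewrite -addnS -(_ : #|O| = #|O :\ a|.+1); last first.
    by rewrite (cardsD1 a O) inE aT oa.
  rewrite -[RHS](cardsID [set t : 'Z_n | ~~ odd t]); congr (_ + _)%N.
    by apply: eq_card => t; rewrite !inE.
  by apply: eq_card => t; rewrite !inE negbK andbC.
pose e : rel 'Z_n := fun x y => y - x \in E.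
have se : symmetric e.
  suff imp x y : e x y -> e y x by move=> x y; apply/idP/idP; apply: imp.
  by rewrite /e !inE -[x - y]opprB => /andP[/symT->]; rewrite opprB !odd_subZ addbC.
have ie : irreflexive e by move=> x; rewrite /e subrr inE (negbTE T0).
have de x : (#|[set y | e x y]| < #|E|.+1)%N.
  rewrite ltnS -(card_imset _ (@addIr _ (- x))); apply/subset_leq_card/subsetP => t.
  by case/imsetP=> y; rewrite inE => ey ->.
have [c0 cc] := vizing se ie de; have [sc0 ec0 pc0] := cc.
have exm x := exists_missing cc (de x).
pose mis x := xchoose (exm x).
have misP x y : c0 x y <> Some (mis x).
  by apply/eqP; have /forallP/(_ y) := xchooseP (exm x).
(* [p] maps the odd residues to the even ones, identifying x with x + a for even x. *)
pose p x : 'Z_n := if odd x then x - a else x.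
pose b x y : 'Z_n := if odd x then x - y else y - x.
(* The default 0 never occurs on an edge, by [evenE]. *)
pose c x y : nat := if odd x == odd y then oapp val 0%N (c0 (p x) (p y))
  else if b x y == a then val (mis (p x))
  else (#|E|.+1 + index (b x y) (enum (O :\ a)))%N.
have pE x y : odd x == odd y -> p y - p x = y - x.
  by rewrite /p => /eqP->; case: ifP => // _; rewrite opprB addrA subrK.
have evenE x y : odd x == odd y -> y - x \in T -> exists d, c0 (p x) (p y) = Some d.
  move=> xy yxT; have := ec0 (p x) (p y); rewrite /e pE // inE yxT odd_subZ.
  by rewrite (eqP xy) addbb /=; case: (c0 _ _) => // d _; exists d.
have bC x y : odd x != odd y -> b x y = b y x.
  by rewrite /b; case: (odd x); case: (odd y).
have bO x y : odd x != odd y -> y - x \in T -> b x y \in O.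
  move=> oxy yxT; rewrite inE /b; case: ifP => ox.
    by rewrite -opprB symT // opprB odd_subZ; move: oxy; rewrite ox; case: (odd y).
  by rewrite yxT odd_subZ; move: oxy; rewrite ox; case: (odd y).
have bI x y z : odd x != odd y -> odd x != odd z -> b x y = b x z -> y = z.
  rewrite /b => _ _; case: ifP => _; first by move/addrI/oppr_inj.
  exact: addIr.
(* Hence the missing color given to an edge of difference a is the same from both ends. *)
have bp x y : odd x != odd y -> b x y = a -> p x = p y.
  rewrite /b /p; case: (odd x); case: (odd y) => // _ <-.
    by rewrite opprB addrC subrK.
  by rewrite opprB addrC subrK.
have idx x y : odd x != odd y -> y - x \in T -> b x y != a ->
    (index (b x y) (enum (O :\ a)) < #|O :\ a|)%N.
  by move=> oxy yxT ba; rewrite cardE index_mem mem_enum in_setD1 ba bO.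
have ord_neq N (d : 'I_N) j : val d <> (N + j)%N.
  by move=> dN; have := ltn_ord d; rewrite -[X in (X < _)%N]/(val d) dN ltnNge leq_addr.
exists c; split=> [x y yxT|x y yxT|x y z yxT zxT].
- rewrite /c -cardT; case: ifPn => oxy.
    have [d ->] := evenE _ _ oxy yxT.
    by apply: leq_trans (ltn_ord d) _; rewrite ltnS leq_addr.
  case: ifPn => ba.
    by apply: leq_trans (ltn_ord (mis (p x))) _; rewrite ltnS leq_addr.
  by rewrite addSn ltnS ltn_add2l idx.
- rewrite /c eq_sym; case: ifPn => oxy; first by rewrite sc0.
  rewrite eq_sym in oxy; rewrite -(bC _ _ oxy); case: ifPn => // /eqP ba.
  by rewrite (bp _ _ oxy ba).
rewrite /c; case: (boolP (odd x == odd y)) => oxy;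
  case: (boolP (odd x == odd z)) => oxz.
- have [d cy] := evenE _ _ oxy yxT; have [f cz] := evenE _ _ oxz zxT.
  rewrite cy cz /= => /val_inj df; rewrite -df in cz.
  have := pc0 _ _ _ _ cy cz; rewrite /p -(eqP oxy) -(eqP oxz).
  by case: ifP => // _; apply: addIr.
- have [d cy] := evenE _ _ oxy yxT; rewrite cy /=; case: ifPn => ba.
    by move/val_inj => dm; case: (misP (p x) (p y)); rewrite cy dm.
  by move/ord_neq.
- have [d cz] := evenE _ _ oxz zxT; rewrite cz /=; case: ifPn => ba.
    by move/val_inj => dm; case: (misP (p x) (p z)); rewrite cz dm.
  by move/esym/ord_neq.
case: (boolP (b x y == a)) => bya; case: (boolP (b x z == a)) => bza.
- by move=> _; apply: bI oxy oxz _; rewrite (eqP bya) (eqP bza).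
- by move/ord_neq.
- by move/esym/ord_neq.
move/addnI => ij; apply: (bI x) => //; apply: (index_inj a _ _ ij).
  by rewrite mem_enum in_setD1 bya bO.
by rewrite mem_enum in_setD1 bza bO.
Qed.

End EvenCyclic.

(** * Degrees and connection sets of Cayley graphs on Z_n *)

Lemma cayley_adjZ (n : nat) (S : {set 'Z_n}) (x y : 'Z_n) :
  cayley_adj S x y = ((y - x)%R \in S).
Proof.
apply/exists_inP/idP => [[s Ss /eqP->]|Sd].
  by rewrite (_ : (x * s)%g = (s + x)%R) ?addrK // addrC.
by exists (y - x)%R => //; rewrite -[(x * _)%g]/(x + (y - x))%R addrC subrK.
Qed.

Lemma max_degree_cayley (n : nat) (S : {set 'Z_n}) (hS : cayley_set S) :
  #|S| <= max_degree (cayley_graph hS).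
Proof.
apply: leq_trans (leq_bigmax (0%R : cayley_graph hS)).
apply/subset_leq_card/subsetP => s Ss; rewrite inE /= cayley_adjZ.
by rewrite subr0.
Qed.

Section Short.

Variables (n m : nat).
Hypotheses (n4m : n = 4 * m) (m_gt0 : 0 < m).

Let n_gt1 : 1 < n. Proof. by rewrite n4m; lia. Qed.
Let n_even : ~~ odd n. Proof. by rewrite n4m oddM. Qed.

Lemma power_cycle_short (x y : 'Z_n) :
  ((y - x)%R \in power_cycle_set n m) = short m x y.
Proof.
have xn := Zn_lt n_gt1 x; have yn := Zn_lt n_gt1 y.
rewrite inE val_subZ // /short /dist; move: xn yn n4m m_gt0.
move: (x : nat) (y : nat) => i j; clear; case: (leqP i j); lia.
Qed.

Lemma card_power_cycle : 2 * m <= #|power_cycle_set n m|.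
Proof.
(* The values are 1, ..., m followed by 3m, ..., 4m - 1. *)
pose f (i : 'I_(2 * m)) : 'Z_n := inZp (if i < m then i.+1 else 2 * m + i).
have fE i : f i = (if i < m then i.+1 else 2 * m + i) :> nat.
  rewrite /f /= (Zp_cast n_gt1) modn_small //.
  by have := ltn_ord i; case: ifP; lia.
rewrite -[2 * m]card_ord -(card_imset _ (_ : injective f)); last first.
  move=> i j /(congr1 (fun x : 'Z_n => x : nat)); rewrite !fE => ij.
  by apply/val_inj; move: ij; rewrite /=; do 2![case: ifP]; lia.
apply/subset_leq_card/subsetP => _ /imsetP[i _ ->].
by rewrite inE fE; have := ltn_ord i; case: ifP; lia.
Qed.

End Short.

(** Otherwise T would lie in the subgroup of even residues, which omits 1. *)
Lemma odd_generator (n : nat) (T : {set 'Z_n}) : 1 < n -> ~~ odd n ->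
  (<<T>> = [set: 'Z_n])%g -> exists2 a, a \in T & odd (a : 'Z_n).
Proof.
move=> n1 en gT; apply/exists_inP; apply: contraT => /exists_inPn noT.
have gE : group_set [set x : 'Z_n | ~~ odd x].
  apply/group_setP; split=> [|x y]; rewrite !inE //.
  by rewrite odd_addZ // => /negbTE-> /negbTE->.
have : <<T>>%g \subset Group gE.
  by rewrite gen_subG; apply/subsetP => t /noT; rewrite inE.
rewrite gT => /subsetP/(_ (1%R : 'Z_n)); rewrite inE => /(_ isT).
by rewrite inE.
Qed.

(** * Combining the two colorings *)

Theorem theorem3p1 (n : nat) (n_gt0 : 0 < n) (n_even : ~~ odd n)
    (S : {set 'Z_n}) (hS : cayley_set S)
    (hDelta : n %/ 2 <= max_degree (cayley_graph hS))
    (hinv : ((n %/ 2)%:R : 'Z_n)%R \notin S)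
    (h4 : 4 %| n)
    (hS1 : power_cycle_set n (n %/ 4) \subset S)
    (hgen : (<<S :\: power_cycle_set n (n %/ 4)>> = [set: 'Z_n])%g) :
  total_chromatic_number (cayley_graph hS) <= max_degree (cayley_graph hS) + 2.
Proof.
set m := n %/ 4 in hS1 hgen *.
have n4m : n = 4 * m by rewrite mulnC divnK.
have m_gt0 : 0 < m by lia.
have n_gt1 : 1 < n by lia.
pose T := S :\: power_cycle_set n m.
have [a aT oa] := odd_generator n_gt1 n_even hgen.
have [symS S0 _] := hS.
have inT x y : ((y - x)%R \in T) = ((y - x)%R \in S) && ~~ short m x y.
  by rewrite in_setD (power_cycle_short n4m) // andbC.
have symT t : t \in T -> (- t)%R \in T.
  rewrite -[t]subr0 opprB !inT shortC => /andP[St ->]; rewrite andbT.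
  by have := symS _ St; rewrite -[(_^-1)%g]/(- _)%R opprB.
have T0 : 0%R \notin T by rewrite in_setD (negbTE S0) andbF.
have [c [ck sc pc]] := even_circulant_class1 n_gt1 n_even symT T0 aT oa.
(* The power of cycle contributes at least 2m elements to S, so its 2m + 2 colors exceed its share
   of the degree by at most 2. *)
have cardS : (2 * m).+2 + #|T| <= max_degree (cayley_graph hS) + 2.
  apply: leq_trans (_ : #|S| + 2 <= _); last by rewrite leq_add2r max_degree_cayley.
  rewrite addn2 !addSn !ltnS -(cardsID (power_cycle_set n m) S) (setIidPr hS1).
  by rewrite leq_add2r card_power_cycle.
rewrite /total_chromatic_number; case: ex_minnP => k _ mink.
apply: mink.
pose col (x y : 'Z_n) := if short m x y then short_color m x y else (2 * m).+2 + c x y.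
have lt4 x : (x : 'Z_n) < 4 * m by rewrite -n4m Zn_lt.
apply: (@total_colorable_nat (cayley_graph hS) _ (fun x : 'Z_n => vertex_color m x) col).
- move=> x; apply: leq_trans cardS; rewrite addSn; apply: ltnW; rewrite ltnS.
  by apply: leq_trans (vertex_color_lt _ _) (leq_addr _ _).
- move=> x y; rewrite /= cayley_adjZ => Sxy; apply: leq_trans cardS; rewrite /col.
  case: ifPn => sxy; first exact: leq_trans (short_color_lt _ _ _) (leq_addr _ _).
  by rewrite ltn_add2l ck // inT Sxy.
- move=> x y; rewrite /= cayley_adjZ => Sxy; rewrite /col shortC short_colorC.
  by case: ifPn => // sxy; rewrite sc // inT Sxy shortC.
- move=> x y; rewrite /= cayley_adjZ => Sxy; apply: vertex_color_inj => //.
    by apply: contraNneq S0 => xy; rewrite -[1%g]/(0%R : 'Z_n) -(subrr x) {1}(val_inj xy).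
  (* At distance 2m the difference y - x would be the involution n/2. *)
  apply: contraNneq hinv => dxy.
  have n2 : n %/ 2 = 2 * m by rewrite n4m; lia.
  rewrite (_ : (n %/ 2)%:R%R = (y - x)%R) //; apply: ord_inj; rewrite val_subZ //.
  rewrite val_Zp_nat // n2 modn_small; last by lia.
  move: dxy (lt4 x) (lt4 y); rewrite /dist.
  by move: (x : nat) (y : nat) => i j; case: (leqP i j); lia.
- move=> x y z; rewrite /= !cayley_adjZ => Sxy Sxz; rewrite /col.
  case: (boolP (short m x y)) => sxy; case: (boolP (short m x z)) => sxz.
  + by move/(short_color_inj m_gt0 (lt4 x) (lt4 y) (lt4 z) sxy sxz)/val_inj.
  + by move=> cxy; have := short_color_lt m x y; rewrite cxy ltnNge leq_addr.
  + by move=> cxz; have := short_color_lt m x z; rewrite -cxz ltnNge leq_addr.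
  by move/addnI; apply: pc; rewrite inT ?Sxy ?Sxz.
move=> x y; rewrite /= cayley_adjZ => Sxy; rewrite /col.
case: ifPn => sxy; first exact: short_color_vertex.
by move=> cx; have := vertex_color_lt m x; rewrite -cx; lia.
Qed.
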